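(* For all $x\ge2$, $$\left|\pi(x)-\mathrm{Li}(x)\right|\le0.4298\,\frac{x}{\log(x)}.$$
   Context: $\pi(x)$ is the number of primes $p\le x$ and $\mathrm{Li}(x)=\int_2^x\frac{dt}{\log t}$. *)

(* Defs.v *)
From mathcomp Require Import ssreflect ssrfun ssrbool eqtype ssrnat seq prime.
From Stdlib Require Import Reals Lra Lia ZArith.
From Coquelicot Require Import Coquelicot.

(* [up x] is the least integer > x, so [p < up x] means [p <= x]
   (see [mem_primes_le]); for negative x the range is empty. *)
Definition primes_le (x : R) : seq nat :=
  [seq p <- seq.iota 0 (Z.to_nat (up x)) | prime p].

Lemma mem_primes_le (x : R) (p : nat) :
  p \in primes_le x <-> prime p /\ (INR p <= x)%R.
Proof.
rewrite /primes_le mem_filter mem_iota add0n leq0n /=.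
have [h1 h2] := archimed x.
split.
  move=> /andP[pp /ltP hp]; split=> //.
  have : (Z.of_nat p <= up x - 1)%Z by lia.
  by move=> /IZR_le; rewrite minus_IZR -INR_IZR_INZ; lra.
move=> [pp hp]; apply/andP; split=> //; apply/ltP.
have : (Z.of_nat p < up x)%Z by apply: lt_IZR; rewrite -INR_IZR_INZ; lra.
lia.
Qed.

Lemma uniq_primes_le (x : R) : uniq (primes_le x).
Proof. by rewrite /primes_le filter_uniq // iota_uniq. Qed.

Definition prime_pi (x : R) : nat := size (primes_le x).

(* The integrand is continuous on [2, x] for x >= 2, so the total operator
   [RInt] gives the actual Riemann integral there. *)
Definition Li (x : R) : R := RInt (fun t : R => / ln t)%R 2 x.

(* Main.v *)
Require Import Defs.
From Stdlib Require Import Reals Lra Lia ZArith.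
From Coquelicot Require Import Coquelicot.
From mathcomp Require Import all_boot zify.

(** Chebyshev's method, with a finite verification below 2000.

    The integers Q(n) = (6n)! n! / ((3n)! (2n)!^2) play the part of the central
    binomial coefficients.  By Legendre's formula the exponent of p in Q(n) is
    a sum, over the powers p^k <= 6n, of terms that depend on the integer part
    of 6n/p^k only and that all equal 0 or 1; the term is 1 whenever k = 1 and
    2n < p <= 6n.  Hence
      prod_(2n < p <= 6n) p <= Q(n) <= (6n)^pi(6n)
    ([primorial_le_cheb], [cheb_le_pow]).  The quotient Q(n+1)/Q(n) is an
    explicit rational number slightly below 108 = 6^6 / (3^3 2^4), so that
    Q(n) is 108^n up to a factor that is at most linear ([cheb_le],
    [cheb_ge]).  As (log 108)/6 = 0.780..., this gives
      theta(x) <= 1.25 x   and   pi(x) >= 0.7799 x/log x - O(1)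
    ([theta_bound], [prime_pi_lower]).  Partial summation turns the first
    estimate into pi(x) <= 1.25 Li(x) + 2.5/log 2 ([primepi_upper]).

    Every comparison with Li is a matter of monotonicity: the derivative of
    r x/log x + s Li(x) is ((r + s) log x - r)/(log x)^2, whose sign is known
    once log x has a lower bound ([Li_comb_le]).  For x >= 2000 it is thus
    enough to know log 2000 and Li(2000) approximately: the upper estimate
    needs 0.25 Li(x) + 3.61 <= 0.4298 x/log x, the lower one needs Li(x) to be
    at most about 1.209 x/log x, and both only improve as x grows.

    Below 2000 the same monotonicity confines the verification to integers,
    since Li(x) - 0.4298 x/log x and Li(x) + 0.4298 x/log x both increase while
    pi is constant on [n, n+1).  A fixed-point recursion on n ([next])
    maintains rigorous bounds for log n, Li(n) and theta(n), from which the
    inequalities are decided ([check]); it ends with the enclosures of log 2000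
    and Li(2000), and with the initial cases of the bound on theta. *)

Set Implicit Arguments.
Unset Strict Implicit.
Local Open Scope nat_scope.

(** * The quotients (6n)! n! / ((3n)! (2n)!^2) *)

Definition primorial (n : nat) : nat := \prod_(0 <= p < n.+1 | prime p) p.

Definition primepi (n : nat) : nat := size [seq p <- iota 0 n.+1 | prime p].

Lemma primepiS n : primepi n.+1 = primepi n + prime n.+1.
Proof.
by rewrite /primepi -addn1 iotaD filter_cat size_cat /=; case: (prime n.+1).
Qed.

Lemma primorialS n :
  primorial n.+1 = primorial n * (if prime n.+1 then n.+1 else 1).
Proof. by rewrite /primorial big_mkcond big_nat_recr //= -big_mkcond. Qed.

Lemma primorial_gt0 n : 0 < primorial n.
Proof. by apply: prodn_cond_gt0 => p /prime_gt0. Qed.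

Lemma leq_primorial m n : m <= n -> primorial m <= primorial n.
Proof.
move=> le_mn; rewrite /primorial [leqRHS](big_cat_nat _ (n := m.+1)) //=.
by rewrite leq_pmulr //; apply: prodn_cond_gt0 => p /prime_gt0.
Qed.

Definition cheb_num n := (6 * n)`! * n`!.
Definition cheb_den n := (3 * n)`! * ((2 * n)`! * (2 * n)`!).
Definition cheb n := cheb_num n %/ cheb_den n.

(** The contribution of p^k to the exponent of p in [cheb n], as a function of
    j = 6n %/ p^k: since m %/ q = (a * m) %/ q %/ a, the four quotients that
    Legendre's formula produces are j, j %/ 6, j %/ 2 and j %/ 3. *)
Definition cheb_exp j := j + j %/ 6 - (j %/ 2 + (j %/ 3 + j %/ 3)).

(** The identity says that the truncated subtraction in [cheb_exp] never
    truncates.  All quantities advance consistently when j grows by 6, so that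
    only the residues of j modulo 6 matter. *)
Lemma cheb_expE j :
  j + j %/ 6 = j %/ 2 + (j %/ 3 + j %/ 3) + cheb_exp j /\ cheb_exp j <= 1.
Proof. rewrite /cheb_exp; lia. Qed.

Lemma cheb_num_gt0 n : 0 < cheb_num n.
Proof. by rewrite muln_gt0 !fact_gt0. Qed.

Lemma cheb_den_gt0 n : 0 < cheb_den n.
Proof. by rewrite !muln_gt0 !fact_gt0. Qed.

(** Legendre's formula with a common range of summation, so that the formulas
    for different factorials can be combined term by term. *)
Lemma logn_fact_wide p m M :
  prime p -> m < M -> logn p m`! = \sum_(1 <= k < M) m %/ p ^ k.
Proof.
move=> pp lt_mM; rewrite logn_fact // [RHS](big_cat_nat _ (n := m.+1)) //=.
rewrite [X in _ = _ + X]big_nat_cond [X in _ = _ + X]big1 ?addn0 // => k.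
rewrite andbT => /andP[lt_mk _]; rewrite divn_small //.
by rewrite (leq_trans lt_mk) // ltnW // ltn_expl ?prime_gt1.
Qed.

Lemma divn_scale a m q : 0 < a -> m %/ q = (a * m) %/ q %/ a.
Proof. by move=> a0; rewrite -divnMA [_ * a]mulnC divnMl. Qed.

Lemma logn_cheb_num p n : prime p ->
  logn p (cheb_num n) = logn p (cheb_den n)
    + \sum_(1 <= k < (6 * n).+1) cheb_exp ((6 * n) %/ p ^ k).
Proof.
move=> pp; rewrite /cheb_num /cheb_den !lognM ?muln_gt0 ?fact_gt0 //.
rewrite !(@logn_fact_wide p _ (6 * n).+1) //; try lia.
rewrite -!big_split /=; apply: eq_bigr => k _.
rewrite (@divn_scale 2 (3 * n)) // (@divn_scale 3 (2 * n)) //.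
rewrite (@divn_scale 6 n) // !mulnA.
by have [] := cheb_expE (6 * n %/ p ^ k).
Qed.

Lemma cheb_den_dvd n : cheb_den n %| cheb_num n.
Proof.
apply/dvdn_partP => [|p]; first exact: cheb_den_gt0.
rewrite mem_primes => /and3P[pp _ _].
by rewrite p_part pfactor_dvdn ?cheb_num_gt0 // logn_cheb_num // leq_addr.
Qed.

Lemma chebE n : cheb_num n = cheb_den n * cheb n.
Proof. by rewrite /cheb mulnC divnK // cheb_den_dvd. Qed.

Lemma cheb_gt0 n : 0 < cheb n.
Proof. by rewrite divn_gt0 ?cheb_den_gt0 // dvdn_leq ?cheb_num_gt0 ?cheb_den_dvd. Qed.

Lemma logn_cheb p n : prime p ->
  logn p (cheb n) = \sum_(1 <= k < (6 * n).+1) cheb_exp ((6 * n) %/ p ^ k).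
Proof.
by move=> pp; rewrite /cheb logn_div ?cheb_den_dvd // logn_cheb_num // addKn.
Qed.

Lemma prod_prime_powers m N : 0 < m ->
  (forall p, prime p -> N < p -> logn p m = 0) ->
  m = \prod_(0 <= p < N.+1 | prime p) p ^ logn p m.
Proof.
move=> m0 hN; rewrite -[LHS](partnT m0) (@widen_partn (maxn m N)) ?leq_maxl //.
rewrite (big_cat_nat _ (n := N.+1)) ?ltnS ?leq_maxr //=.
rewrite [X in _ * X]big_nat_cond [X in _ * X]big1 ?muln1.
  rewrite [RHS]big_mkcond; apply: eq_bigr => p _ /=.
  by case: ifP => // np; rewrite /logn np.
move=> p /=; rewrite andbT => /andP[ltNp _].
by case: (boolP (prime p)) => [pp|/negbTE np]; [rewrite hN|rewrite /logn np].
Qed.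

Lemma prod_cheb n : cheb n = \prod_(0 <= p < (6 * n).+1 | prime p) p ^ logn p (cheb n).
Proof.
apply: prod_prime_powers (cheb_gt0 n) _ => p pp lt_np.
rewrite logn_cheb // big_nat_cond big1 // => k; rewrite andbT => /andP[k1 _].
rewrite divn_small; first by [].
apply: leq_trans lt_np _.
by rewrite -{1}(expn1 p) leq_exp2l ?prime_gt1.
Qed.

(** The exponent counts at most one for each k with p^k <= 6n, hence is at
    most the integer part of log_p (6n). *)
Lemma pow_logn_cheb p n : 0 < n -> prime p -> p ^ logn p (cheb n) <= 6 * n.
Proof.
move=> n0 pp; have N0 : 0 < 6 * n by lia.
apply: leq_trans (trunc_logP (prime_gt1 pp) N0); rewrite leq_exp2l ?prime_gt1 //.
have lt_tN : trunc_log p (6 * n) < (6 * n).+1.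
  apply: (@leq_ltn_trans (p ^ trunc_log p (6 * n))).
    by rewrite ltnW // ltn_expl ?prime_gt1.
  by rewrite ltnS trunc_logP ?prime_gt1.
rewrite logn_cheb // (big_cat_nat _ (n := (trunc_log p (6 * n)).+1)) //=.
rewrite [X in _ + X]big_nat_cond [X in _ + X]big1 ?addn0; last first.
  move=> k; rewrite andbT => /andP[lt_tk _].
  rewrite divn_small // ltnNge; apply/negP => /(trunc_log_max (prime_gt1 pp)).
  by rewrite leqNgt lt_tk.
apply: (@leq_trans (\sum_(1 <= k < (trunc_log p (6 * n)).+1) 1)).
  by apply: leq_sum => k _; have [] := cheb_expE (6 * n %/ p ^ k).
by rewrite sum_nat_const_nat muln1 subn1.
Qed.

Lemma cheb_le_pow n : 0 < n -> cheb n <= (6 * n) ^ primepi (6 * n).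
Proof.
move=> n0; rewrite prod_cheb /primepi -big_filter /index_iota subn0.
have : all prime [seq p <- iota 0 (6 * n).+1 | prime p] by rewrite filter_all.
elim: [seq _ <- _ | _] => [|p s IH] /=; first by rewrite big_nil.
case/andP=> pp sp; rewrite big_cons expnS leq_mul ?IH //.
exact: pow_logn_cheb.
Qed.

(** A prime p with 2n < p <= 6n has 6n %/ p equal to 1 or 2, where [cheb_exp]
    is 1; so p divides [cheb n]. *)
Lemma primorial_le_cheb n : primorial (6 * n) <= primorial (2 * n) * cheb n.
Proof.
rewrite prod_cheb {1}/primorial (big_cat_nat _ (n := (2 * n).+1)) //=; last by lia.
rewrite leq_mul2l [X in _ <= X](big_cat_nat _ (n := (2 * n).+1)) //=; last by lia.
apply/orP; right; rewrite -[leqLHS]mul1n leq_mul //.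
  by apply: prodn_cond_gt0 => p pp; rewrite expn_gt0 prime_gt0.
rewrite big_nat_cond [leqRHS]big_nat_cond; apply: leq_prod => p /andP[/andP[lt2 lt6] pp].
rewrite -{1}[p]expn1 leq_exp2l ?prime_gt1 // logn_cheb //.
rewrite (big_cat_nat _ (n := 2)) //=; last by case: (n) lt2 lt6 => //; lia.
rewrite big_nat1 expn1 -[X in X <= _]addn0 leq_add //.
have : 6 * n %/ p = 1 \/ 6 * n %/ p = 2.
  have : 0 < 6 * n %/ p by rewrite divn_gt0 ?prime_gt0.
  have : 6 * n %/ p < 3 by rewrite ltn_divLR ?prime_gt0 //; lia.
  lia.
by case=> ->.
Qed.

Lemma cheb_rec n :
  cheb n.+1 * ((2 * n + 1) * (n + 1)) = cheb n * (6 * (6 * n + 1) * (6 * n + 5)).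
Proof.
have d0 : 0 < cheb_den n.+1 by exact: cheb_den_gt0.
apply/eqP; rewrite -(eqn_pmul2l d0) mulnA -chebE; apply/eqP.
have hN : cheb_num n.+1 = cheb_num n * ((6 * n + 6) * (6 * n + 5) * (6 * n + 4)
   * (6 * n + 3) * (6 * n + 2) * (6 * n + 1) * (n + 1)).
  rewrite /cheb_num (_ : 6 * n.+1 = (6 * n).+4.+2); last by lia.
  rewrite !factS; move: (_`!) (_`!) => a b; nia.
have hD : cheb_den n.+1 = cheb_den n * ((3 * n + 3) * (3 * n + 2) * (3 * n + 1)
   * ((2 * n + 2) * (2 * n + 1)) * ((2 * n + 2) * (2 * n + 1))).
  rewrite /cheb_den (_ : 3 * n.+1 = (3 * n).+3) 1?(_ : 2 * n.+1 = (2 * n).+2); try lia.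
  rewrite !factS; move: (_`!) (_`!) => a b; nia.
rewrite hN hD chebE; nia.
Qed.

(** By [cheb_rec] the quotient of consecutive terms is
    108 (36n^2 + 36n + 5) / (36n^2 + 54n + 18), which is below 108. *)
Lemma cheb_le n : cheb n <= 108 ^ n.
Proof.
elim: n => [|n IH]; first by rewrite /cheb /cheb_num /cheb_den /=.
have := cheb_rec n; rewrite expnS; nia.
Qed.

(** The quotient of consecutive terms is 108 (1 - 1/(2n) + ...), so [cheb n]
    behaves like 108^n / sqrt n; comparison with 108^n / (n + 1) loses little
    and keeps the induction rational.  The inductive inequality fails at n = 0
    only, whence the factor 2 and the separate first step. *)
Lemma cheb_ge n : 108 ^ n <= 2 * n.+1 * cheb n.
Proof.
elim: n => [|n IH]; first by [].
case: n IH => [|n] IH; first by vm_compute.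
have := cheb_rec n.+1; move: IH; rewrite (expnS 108 n.+1).
move: (cheb n.+1) (cheb n.+2) (108 ^ _) => a b c; nia.
Qed.

(** * Monotonicity and enclosures of log and Li *)

Open Scope R_scope.

Lemma le_of_derive_ge0 (f df : R -> R) (a b : R) : a <= b ->
  (forall t, a <= t <= b -> is_derive f t (df t)) ->
  (forall t, a <= t <= b -> 0 <= df t) -> f a <= f b.
Proof.
move=> le_ab Df df0.
have [||c []] := MVT_gen f a b df; rewrite ?Rmin_left ?Rmax_right //.
- by move=> t ht; apply: Df; lra.
- move=> t ht; apply: derivable_continuous_pt.
  by exists (df t); apply/is_derive_Reals/Df.
- by move=> /df0 ? ?; nra.
Qed.

Lemma ln_gt0 t : 1 < t -> 0 < ln t.
Proof. by move=> t1; rewrite -ln_1; apply: ln_increasing; lra. Qed.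

(** The difference of the two sides has derivative (b - a)^2 / (b (a + b)^2) in
    b.  This and [ln_diff_le] are exact up to third order in (b - a) / a, which
    is what allows logarithms to be computed by accumulating increments. *)
Lemma ln_diff_ge a b : 0 < a -> a <= b -> 2 * (b - a) / (a + b) <= ln b - ln a.
Proof.
move=> a0 le_ab.
pose f t := ln t - 2 * (t - a) / (a + t).
pose df t := (t - a) * (t - a) / (t * ((a + t) * (a + t))).
suff : f a <= f b by rewrite /f /Rminus Rplus_opp_r; lra.
apply: (@le_of_derive_ge0 _ df) => // t ht; rewrite /f /df.
  by auto_derive; [lra | field; lra].
by apply: Rdiv_le_0_compat; [nra | apply: Rmult_lt_0_compat; nra].
Qed.

Lemma ln_diff_le a b : 0 < a -> a <= b -> ln b - ln a <= (b / a - a / b) / 2.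
Proof.
move=> a0 le_ab.
pose f t := (t / a - a / t) / 2 - ln t.
pose df t := (t - a) * (t - a) / (2 * a * (t * t)).
suff : f a <= f b.
  rewrite /f; have -> : a / a = 1; [by field; lra | lra].
apply: (@le_of_derive_ge0 _ df) => // t ht; rewrite /f /df.
  by auto_derive; [lra | field; lra].
apply: Rdiv_le_0_compat; first by nra.
by apply: Rmult_lt_0_compat; nra.
Qed.

(** The ratios 16/15, 25/24 and 81/80 involve the primes 2, 3 and 5 only and
    are close to 1; their logarithms are independent combinations of log 2,
    log 3 and log 5, and solving the linear system gives the bounds. *)
Lemma ln_2_3_bounds :
  (0.6929 <= ln 2 <= 0.6936) /\ (1.098 <= ln 3 <= 1.0992).
Proof.
have lnM x y : 0 < x -> 0 < y -> ln (x * y) = ln x + ln y by exact: ln_mult.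
have ln16 : ln 16 = 4 * ln 2.
  by rewrite (_ : 16 = 2 * 2 * (2 * 2)) ?lnM; lra.
have ln15 : ln 15 = ln 3 + ln 5.
  by rewrite (_ : 15 = 3 * 5) ?lnM; lra.
have ln25 : ln 25 = 2 * ln 5.
  by rewrite (_ : 25 = 5 * 5) ?lnM; lra.
have ln24 : ln 24 = 3 * ln 2 + ln 3.
  by rewrite (_ : 24 = 2 * 2 * 2 * 3) ?lnM; lra.
have ln81 : ln 81 = 4 * ln 3.
  by rewrite (_ : 81 = 3 * 3 * (3 * 3)) ?lnM; lra.
have ln80 : ln 80 = 4 * ln 2 + ln 5.
  by rewrite (_ : 80 = 2 * 2 * (2 * 2) * 5) ?lnM; lra.
have := @ln_diff_ge 15 16; have := @ln_diff_le 15 16.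
have := @ln_diff_ge 24 25; have := @ln_diff_le 24 25.
have := @ln_diff_ge 80 81; have := @ln_diff_le 80 81.
by rewrite ln16 ln15 ln25 ln24 ln81 ln80; split; lra.
Qed.

Lemma continuous_inv_ln t : 1 < t -> continuous (fun t => / ln t) t.
Proof.
move=> t1; apply: (@ex_derive_continuous R_AbsRing R_NormedModule).
by auto_derive; have := ln_gt0 t1; lra.
Qed.

Lemma is_derive_Li t : 1 < t -> is_derive Li t (/ ln t).
Proof.
move=> t1; apply: (is_derive_RInt (fun t => / ln t) Li 2).
  exists (mkposreal (t - 1) ltac:(lra)) => y /Rabs_def2 /= hy.
  rewrite /minus /plus /opp /= in hy.
  apply: (@RInt_correct R_CompleteNormedModule).
  apply: (@ex_RInt_continuous R_CompleteNormedModule) => z hz.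
  apply: continuous_inv_ln.
  by have := Rmin_glb_lt 2 y 1 ltac:(lra) ltac:(lra); lra.
exact: continuous_inv_ln.
Qed.

Lemma Li_2 : Li 2 = 0.
Proof. exact: RInt_point. Qed.

(** The derivative of the compared function is
    ((r + s) log t - r) / (log t)^2.  Signed coefficients let one statement
    cover both sides of every comparison of Li with a multiple of x/log x. *)
Lemma Li_comb_le r s a b : 1 < a -> a <= b ->
  (forall t, a <= t <= b -> r <= (r + s) * ln t) ->
  r * (a / ln a) + s * Li a <= r * (b / ln b) + s * Li b.
Proof.
move=> a1 le_ab hrs.
pose df t := ((r + s) * ln t - r) / (ln t * ln t).
apply: (@le_of_derive_ge0 (fun t => r * (t / ln t) + s * Li t) df) => // t ht.
  have L0 : 0 < ln t by apply: ln_gt0; lra.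
  have -> : df t = r * ((1 * ln t - / t * t) / (ln t ^ 2)) + s * / ln t.
    by rewrite /df; field; lra.
  apply: (@is_derive_plus R_AbsRing R_NormedModule); apply: is_derive_scal.
    by auto_derive; [lra | field; lra].
  by apply: is_derive_Li; lra.
have L0 : 0 < ln t by apply: ln_gt0; lra.
have := hrs t ht => ?; rewrite /df.
by apply: Rdiv_le_0_compat; nra.
Qed.

Lemma Li_le a b : 1 < a -> a <= b -> Li a <= Li b.
Proof.
move=> a1 le_ab; have := @Li_comb_le 0 1 a b a1 le_ab.
suff h t : a <= t <= b -> 0 <= (0 + 1) * ln t by move=> /(_ h); lra.
by move=> ht; have := @ln_gt0 t; lra.
Qed.

Lemma Li_diff_ge a b : 1 < a -> a <= b -> (b - a) / ln b <= Li b - Li a.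
Proof.
move=> a1 le_ab.
pose f t := Li t - t * / ln b.
suff : f a <= f b by rewrite /f; lra.
apply: (@le_of_derive_ge0 _ (fun t => / ln t - / ln b)) => // t ht.
  apply: (@is_derive_minus R_AbsRing R_NormedModule).
    by apply: is_derive_Li; lra.
  by auto_derive => //; ring.
suff : / ln b <= / ln t by lra.
apply: Rinv_le_contravar; first by apply: ln_gt0; lra.
by apply: ln_le; lra.
Qed.

(** Concavity of the logarithm puts log t above its chord s, and the weighted
    harmonic-arithmetic mean inequality bounds 1/s by the chord of 1/log. *)
Lemma inv_ln_le_chord a t : 1 < a -> a <= t <= a + 1 ->
  / ln t <= (a + 1 - t) / ln a + (t - a) / ln (a + 1).
Proof.
move=> a1 ht.
have La : 0 < ln a by apply: ln_gt0; lra.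
have Lb : 0 < ln (a + 1) by apply: ln_gt0; lra.
have tangent u : 0 < u -> ln u <= ln t + (u - t) / t.
  move=> u0; have := exp_ineq1_le ((u - t) / t).
  rewrite (_ : 1 + (u - t) / t = u / t); last by field; lra.
  move=> /ln_le; rewrite ln_exp ln_div; try lra.
  by move=> /(_ ltac:(apply: Rdiv_lt_0_compat; lra)); lra.
pose s := (a + 1 - t) * ln a + (t - a) * ln (a + 1).
have hs : s <= ln t.
  have := Rmult_le_compat_l (a + 1 - t) _ _ ltac:(lra) (tangent a ltac:(lra)).
  have := Rmult_le_compat_l (t - a) _ _ ltac:(lra) (tangent (a + 1) ltac:(lra)).
  have : (a + 1 - t) * ((a - t) / t) + (t - a) * ((a + 1 - t) / t) = 0 by (field; lra).
  by rewrite /s; lra.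
have s0 : 0 < s by rewrite /s; nra.
apply: (Rle_trans _ (/ s)); first exact: Rinv_le_contravar.
apply: (Rmult_le_reg_l (s * (ln a * ln (a + 1)))).
  by apply: Rmult_lt_0_compat => //; apply: Rmult_lt_0_compat.
have -> : s * (ln a * ln (a + 1)) * / s = ln a * ln (a + 1) by (field; lra).
have -> : s * (ln a * ln (a + 1)) * ((a + 1 - t) / ln a + (t - a) / ln (a + 1)) =
  s * ((a + 1 - t) * ln (a + 1) + (t - a) * ln a) by (field; lra).
have -> : s * ((a + 1 - t) * ln (a + 1) + (t - a) * ln a) = ln a * ln (a + 1)
  + (t - a) * (a + 1 - t) * ((ln (a + 1) - ln a) * (ln (a + 1) - ln a)).
  by rewrite /s; ring.
have h1 : 0 <= (t - a) * (a + 1 - t) by nra.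
by have := Rmult_le_pos _ _ h1 (Rle_0_sqr (ln (a + 1) - ln a)); rewrite /Rsqr; lra.
Qed.

(** The trapezoid rule overestimates, 1/log being convex.  The plain left
    endpoint rule would be too coarse near 2. *)
Lemma Li_succ_le a : 1 < a -> Li (a + 1) <= Li a + (/ ln a + / ln (a + 1)) / 2.
Proof.
move=> a1; set p := / ln a; set q := / ln (a + 1).
(* g is the antiderivative of the chord of 1/log over [a, a + 1]. *)
pose g t := (q * ((t - a) * (t - a)) - p * ((a + 1 - t) * (a + 1 - t))) / 2.
suff : g a - Li a <= g (a + 1) - Li (a + 1).
  have -> : g a = - p / 2 by rewrite /g; field.
  have -> : g (a + 1) = q / 2 by rewrite /g; field.
  by lra.
apply: (@le_of_derive_ge0 (fun t => g t - Li t)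
  (fun t => ((a + 1 - t) * p + (t - a) * q) - / ln t)); first lra.
  move=> t ht; apply: (@is_derive_minus R_AbsRing R_NormedModule).
    by rewrite /g; auto_derive => //; field.
  by apply: is_derive_Li; lra.
by move=> t ht; have := inv_ln_le_chord a1 ht; rewrite /p /q /Rdiv; lra.
Qed.

(** * Bounds for theta and pi *)

Lemma nat_floor x : 0 <= x -> exists n : nat, INR n <= x < INR n.+1.
Proof.
move=> x0; have [n ?] := nfloor_ex x x0.
by exists n; rewrite S_INR.
Qed.

Lemma prime_piE x n : INR n <= x < INR n.+1 -> prime_pi x = primepi n.
Proof.
move=> hx; rewrite /prime_pi /primes_le /primepi.
have <- : Z.of_nat n.+1 = up x by apply: tech_up; rewrite -INR_IZR_INZ ?S_INR in hx *; lra.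
by rewrite Nat2Z.id.
Qed.

Lemma INR_expn m k : INR (m ^ k)%N = INR m ^ k.
Proof. by elim: k => [|k IH] //; rewrite expnS mult_INR IH. Qed.

Lemma leq_INR m n : (m <= n)%N -> INR m <= INR n.
Proof. by move=> h; apply: le_INR; lia. Qed.

Definition theta n := ln (INR (primorial n)).

Lemma INR_gt0 n : (0 < n)%N -> 0 < INR n.
Proof. by move=> h; apply: lt_0_INR; lia. Qed.

Lemma thetaS n : theta n.+1 = theta n + (if prime n.+1 then ln (INR n.+1) else 0).
Proof.
rewrite /theta primorialS; case: ifP => _; last by rewrite muln1 Rplus_0_r.
by rewrite mult_INR ln_mult //; apply: INR_gt0; rewrite // primorial_gt0.
Qed.

Lemma theta_le m n : (m <= n)%N -> theta m <= theta n.
Proof.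
move=> le_mn; apply: ln_le; first by apply: INR_gt0; exact: primorial_gt0.
by apply: leq_INR; exact: leq_primorial.
Qed.

Lemma ln_108 : ln 108 = 2 * ln 2 + 3 * ln 3.
Proof.
rewrite (_ : 108 = 2 * 2 * (3 * 3 * 3)); last by lra.
by rewrite !ln_mult; lra.
Qed.

Lemma INR_108 : INR 108 = 108.
Proof. by rewrite INR_IZR_INZ. Qed.

Lemma theta_diff_le n : theta (6 * n) <= theta (2 * n) + INR n * ln 108.
Proof.
have h2 := INR_gt0 (primorial_gt0 (2 * n)).
rewrite -ln_pow; try lra; rewrite -ln_mult //; last by apply: pow_lt; lra.
apply: ln_le; first by apply: INR_gt0; exact: primorial_gt0.
rewrite -INR_108 -INR_expn -mult_INR; apply: leq_INR.
apply: (leq_trans (primorial_le_cheb n)).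
by rewrite leq_mul2l cheb_le orbT.
Qed.

(** The strong induction compares m with 6k and 2k, where k is m/6 rounded up:
    theta(m) <= theta(2k) + k log 108 <= (2.5 + 4.685) k with k <= (m + 5)/6.
    Since 7.185/6 < 1.25, the rounding is absorbed for large m. *)
Lemma theta_upper : (forall m, (m < 2000)%N -> theta m <= 1.25 * INR m) ->
  forall m, theta m <= 1.25 * INR m.
Proof.
move=> base; elim/ltn_ind => m IH.
have [/base //|le_m] := ltnP m 2000.
pose k := ((m + 5) %/ 6)%N.
have hk : (m <= 6 * k)%N /\ (6 * k <= m + 5)%N by rewrite /k; lia.
have := theta_le hk.1; have := theta_diff_le k.
have := IH (2 * k)%N ltac:(lia); rewrite mult_INR.
have := leq_INR hk.2; rewrite mult_INR plus_INR.
have := leq_INR le_m.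
rewrite ln_108 !INR_IZR_INZ.
have [? ?] := ln_2_3_bounds; have : 0 <= IZR (Z.of_nat k) by apply: IZR_le; lia.
rewrite /=; nra.
Qed.

(** Partial summation as an induction on n.  When n grows by one the quantity
    pi(n) + (1.25 n - theta(n))/log n grows by at most 1.25/log (n + 1): a new
    prime adds 1 to pi(n) and log (n + 1) to theta(n), which cancel, and the
    change of denominator decreases the nonnegative fraction.  On the other
    side Li grows by at least 1/log (n + 1). *)
Lemma primepi_upper n : (1 < n)%N -> (forall m, theta m <= 1.25 * INR m) ->
  INR (primepi n) <= 1.25 * Li (INR n) + 2.5 / ln 2.
Proof.
move=> n1 hth.
suff : INR (primepi n) + (1.25 * INR n - theta n) / ln (INR n)
    <= 1.25 * Li (INR n) + 2.5 / ln 2.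
  have L0 : 0 < ln (INR n) by apply: ln_gt0; apply: (lt_INR 1); lia.
  have : 0 <= (1.25 * INR n - theta n) / ln (INR n).
    by apply: Rdiv_le_0_compat => //; have := hth n; lra.
  by lra.
elim: n n1 => // n IH; rewrite ltnS leq_eqVlt => /orP[/eqP <-|n1].
  have -> : primepi 2 = 1%N by [].
  have -> : theta 2 = ln 2 by rewrite /theta /primorial unlock.
  have ? := ln_gt0 (t := 2) ltac:(lra).
  rewrite (_ : INR 2 = 2) // (_ : INR 1 = 1) // Li_2 /Rdiv.
  by have := Rinv_r (ln 2) ltac:(lra); lra.
have {}IH := IH n1.
have hn : 1 < INR n by apply: (lt_INR 1); lia.
have L0 : 0 < ln (INR n) by apply: ln_gt0.
have L1 : 0 < ln (INR n.+1) by apply: ln_gt0; rewrite S_INR; lra.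
have LL : / ln (INR n.+1) <= / ln (INR n).
  by apply: Rinv_le_contravar => //; apply: ln_le; rewrite ?S_INR; lra.
have := @Li_diff_ge (INR n) (INR n.+1) hn ltac:(rewrite S_INR; lra).
have -> : INR n.+1 - INR n = 1 by rewrite S_INR; lra.
have hd : (1.25 * INR n - theta n) / ln (INR n.+1) <= (1.25 * INR n - theta n) / ln (INR n).
  by apply: Rmult_le_compat_l => //; have := hth n; lra.
suff -> : INR (primepi n.+1) + (1.25 * INR n.+1 - theta n.+1) / ln (INR n.+1)
   = INR (primepi n) + (1.25 * INR n - theta n) / ln (INR n.+1) + 1.25 * (1 / ln (INR n.+1)).
  by lra.
rewrite primepiS thetaS plus_INR [in 1.25 * _]S_INR.
have := Rinv_r (ln (INR n.+1)) ltac:(lra).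
by case: (prime n.+1); rewrite /Rdiv /=; lra.
Qed.

(** The logarithm of 108^n <= 2 (n + 1) Q(n) <= 2 (n + 1) (6n)^pi(6n). *)
Lemma primepi_lower n : (0 < n)%N ->
  INR n * ln 108 <= ln (INR (2 * n.+1)) + INR (primepi (6 * n)) * ln (INR (6 * n)).
Proof.
move=> n0.
have h6 : 0 < INR (6 * n) by apply: INR_gt0; lia.
have h2 : 0 < INR (2 * n.+1) by apply: INR_gt0; lia.
rewrite -!ln_pow //; try lra; rewrite -ln_mult //; last by apply: pow_lt.
apply: ln_le; first by apply: pow_lt; lra.
rewrite -INR_108 -!INR_expn -mult_INR; apply: leq_INR.
apply: (leq_trans (cheb_ge n)).
by rewrite leq_mul2l cheb_le_pow ?orbT.
Qed.

Lemma leq_primepi m n : (m <= n)%N -> (primepi m <= primepi n)%N.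
Proof.
move=> /subnK <-; elim: (n - m)%N => // k IH.
by rewrite addSn primepiS; apply: leq_trans IH (leq_addr _ _).
Qed.

(** [primepi_lower] at the largest multiple 6n of 6 that is at most x; the
    factor 2 (n + 1) is at most x. *)
Lemma prime_pi_lower x : 6 <= x ->
  (x / 6 - 1) * ln 108 <= (1 + INR (prime_pi x)) * ln x.
Proof.
move=> x6; have [n hn] := nat_floor (x := x) ltac:(lra).
rewrite (prime_piE hn); rewrite S_INR in hn.
pose k := (n %/ 6)%N.
have n6 : (5 < n)%N by apply/ltP/INR_lt; rewrite /=; lra.
have k0 : (0 < k)%N by rewrite /k; lia.
have hk : (6 * k <= n)%N /\ (n < 6 * k + 6)%N by rewrite /k; lia.
have h2k : (2 * k.+1 <= n)%N by lia.
have := primepi_lower k0.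
have h6 := leq_INR hk.1; have := leq_INR hk.2; have := leq_INR h2k.
have : INR (primepi (6 * k)) <= INR (primepi n) by apply: leq_INR; apply: leq_primepi hk.1.
have i0 : 0 < INR (2 * k.+1) by apply: INR_gt0; lia.
have i1 : 0 < INR (6 * k) by apply: INR_gt0; lia.
move=> hpi h2 h7.
have : ln (INR (2 * k.+1)) <= ln x by apply: ln_le => //; lra.
have : ln (INR (6 * k)) <= ln x by apply: ln_le => //; lra.
have : 0 <= ln (INR (6 * k)).
  by rewrite -ln_1; apply: ln_le; [lra | apply: (leq_INR (m := 1)); lia].
have : 0 <= INR (primepi (6 * k)) by exact: pos_INR.
have : 0 <= ln 108 by rewrite -ln_1; apply: ln_le; lra.
have : x / 6 - 1 <= INR k.
  by move: h7; rewrite S_INR plus_INR mult_INR (_ : INR 6 = 6) /=; lra.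
move: (ln _) (ln _) (ln _) (ln _) => a b c d; nra.
Qed.

(** * A fixed-point recursion for log, Li and theta at integers *)

Definition scale : Z := 1000000.

Record enclosure := Enclosure {
  arg : nat;
  pi_val : nat;
  ln_lo : Z;
  ln_up : Z;
  Li_up : Z;
  theta_up : Z }.

Definition encloses (s : enclosure) :=
  (1 < arg s)%N /\ pi_val s = primepi (arg s) /\ (0 < ln_lo s)%Z /\
  IZR (ln_lo s) <= IZR scale * ln (INR (arg s)) <= IZR (ln_up s) /\
  IZR scale * Li (INR (arg s)) <= IZR (Li_up s) /\
  IZR scale * theta (arg s) <= IZR (theta_up s).

(** The increments come from [ln_diff_ge], [ln_diff_le] and [Li_succ_le] with
    a = n and b = n + 1; lower bounds are rounded down, upper bounds up. *)
Definition next (s : enclosure) : enclosure :=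
  let n := Z.of_nat (arg s) in
  let l := (ln_lo s + 2 * scale / (2 * n + 1))%Z in
  let u := (ln_up s + (scale * (2 * n + 1) / (2 * n * (n + 1)) + 1))%Z in
  let b := (Li_up s + (scale * scale * (ln_lo s + l) / (2 * ln_lo s * l) + 1))%Z in
  let isp := prime (arg s).+1 in
  Enclosure (arg s).+1 (pi_val s + isp) l u b
    (if isp then theta_up s + u else theta_up s)%Z.

(** The second test is pi(n) log n <= 1.4298 n - 2, which is enough for the
    upper estimate because Li(n) >= (n - 2)/log n.  The third one compares
    Li(n+1) - 0.4298 (n+1)/log (n+1) with pi(n), the value of pi on [n, n+1). *)
Definition check (s : enclosure) : bool :=
  let n := Z.of_nat (arg s) in
  let k := Z.of_nat (pi_val s) in
  let s' := next s in
  [&& (4 * theta_up s <=? 5 * n * scale)%Z,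
      (10000 * (k * ln_up s) <=? (14298 * n - 20000) * scale)%Z &
      (10000 * ((Li_up s' - k * scale) * ln_up s')
         <=? 4298 * (n + 1) * (scale * scale))%Z].

Fixpoint sweep (fuel : nat) (s : enclosure) : option enclosure :=
  if fuel is fuel'.+1 then
    if check s then sweep fuel' (next s) else None
  else Some s.

(** At 2 the bounds on log 2 are those of [ln_2_3_bounds], Li(2) = 0 and
    theta(2) = log 2. *)
Definition start := Enclosure 2 1 692900 693600 0 693600.

Definition pi_Li_close x :=
  Rabs (INR (prime_pi x) - Li x) <= 0.4298 * (x / ln x).

Lemma Zdiv_bounds a b : (0 < b)%Z ->
  IZR (a / b)%Z <= IZR a / IZR b <= IZR (a / b + 1)%Z.
Proof.
move=> b0; have b0' := IZR_lt _ _ b0.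
have h1 : (b * (a / b) <= a)%Z by apply: Z.mul_div_le.
have h2 : (a <= b * (a / b + 1))%Z by have := Z.mul_succ_div_gt a b b0; lia.
move/IZR_le: h1; move/IZR_le: h2; rewrite !mult_IZR => h2 h1.
split; apply: (Rmult_le_reg_l (IZR b)) => //.
  by have -> : IZR b * (IZR a / IZR b) = IZR a; [field; lra | ].
by have -> : IZR b * (IZR a / IZR b) = IZR a; [field; lra | ].
Qed.

Lemma start_encloses : encloses start.
Proof.
have th2 : theta 2 = ln 2 by rewrite /theta /primorial unlock.
have [? ?] := ln_2_3_bounds.
rewrite /encloses [arg _]/= th2 (_ : INR 2 = 2) // Li_2 /scale /=.
by repeat split; try lra; try lia.
Qed.

Lemma next_encloses s : encloses s -> encloses (next s).
Proof.
case: s => n k l u b t; rewrite /encloses /next.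
cbn [arg pi_val ln_lo ln_up Li_up theta_up].
move=> [n1 [hk [l0 [[hl hu] [hb ht]]]]].
have hn : 1 < INR n by apply: (lt_INR 1); lia.
have S0 : 0 < IZR scale by apply: IZR_lt.
have EN : IZR (Z.of_nat n) = INR n by rewrite INR_IZR_INZ.
set l' := (l + _)%Z; set u' := (u + _)%Z; set b' := (b + _)%Z.
have hl' : IZR l' <= IZR scale * ln (INR n.+1).
  have := Zdiv_bounds (2 * scale) (b := 2 * Z.of_nat n + 1) ltac:(lia).
  have := @ln_diff_ge (INR n) (INR n + 1) ltac:(lra) ltac:(lra).
  rewrite /l' S_INR !plus_IZR !mult_IZR EN => h [h1 _].
  have := Rmult_le_compat_l _ _ _ (Rlt_le _ _ S0) h.
  have -> : IZR scale * (2 * (INR n + 1 - INR n) / (INR n + (INR n + 1)))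
    = 2 * IZR scale / (2 * INR n + 1) by field; lra.
  by lra.
have hu' : IZR scale * ln (INR n.+1) <= IZR u'.
  have := Zdiv_bounds (scale * (2 * Z.of_nat n + 1))
    (b := 2 * Z.of_nat n * (Z.of_nat n + 1)) ltac:(nia).
  have := @ln_diff_le (INR n) (INR n + 1) ltac:(lra) ltac:(lra).
  rewrite /u' S_INR !(plus_IZR, mult_IZR) EN => h [_ h1].
  have := Rmult_le_compat_l _ _ _ (Rlt_le _ _ S0) h.
  have -> : IZR scale * (((INR n + 1) / INR n - INR n / (INR n + 1)) / 2)
    = IZR scale * (2 * INR n + 1) / (2 * INR n * (INR n + 1)) by field; lra.
  by lra.
have l'0 : (0 < l')%Z.
  by rewrite /l'; have := Z.div_pos (2 * scale) (2 * Z.of_nat n + 1)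
     ltac:(rewrite /scale; lia) ltac:(lia); lia.
have hb' : IZR scale * Li (INR n.+1) <= IZR b'.
  have := Zdiv_bounds (scale * scale * (l + l')) (b := 2 * l * l') ltac:(nia).
  have := Li_succ_le hn.
  rewrite -S_INR /b' !plus_IZR !mult_IZR plus_IZR => h [_ h1].
  have lR := IZR_lt _ _ l0; have l'R := IZR_lt _ _ l'0.
  have inv_le x y : 0 < x -> x <= IZR scale * y -> / y <= IZR scale / x.
    move=> x0 hxy.
    have -> : IZR scale / x = / (x / IZR scale) by field; lra.
    apply: Rinv_le_contravar; first exact: Rdiv_lt_0_compat.
    by apply: (Rmult_le_reg_l (IZR scale)) => //; field_simplify; lra.
  have h2 := inv_le _ _ lR hl; have h3 := inv_le _ _ l'R hl'.
  have h4 : Li (INR n.+1) <= Li (INR n) + (IZR scale / IZR l + IZR scale / IZR l') / 2 by lra.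
  have := Rmult_le_compat_l _ _ _ (Rlt_le _ _ S0) h4.
  have -> : IZR scale * (Li (INR n) + (IZR scale / IZR l + IZR scale / IZR l') / 2)
    = IZR scale * Li (INR n)
      + IZR scale * IZR scale * (IZR l + IZR l') / (2 * IZR l * IZR l') by field; lra.
  by lra.
split; first by lia.
split; first by rewrite primepiS hk.
do 3 (split; first by []).
rewrite thetaS; case: ifP => _; last by lra.
by rewrite plus_IZR; lra.
Qed.

(** [up] and [lo] reduce the claim for x to the end points n and n + 1. *)
Lemma check_correct s : encloses s -> check s ->
  theta (arg s) <= 1.25 * INR (arg s) /\
  forall x, INR (arg s) <= x < INR (arg s).+1 -> pi_Li_close x.
Proof.
move=> es /and3P[/Z.leb_le h1 /Z.leb_le h2 /Z.leb_le h3].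
have := next_encloses es; move: h1 h2 h3; set s' := next s.
have : arg s' = (arg s).+1 by [].
case: s es s' => n k l u b t es; case=> n' k' l' u' b' t'.
rewrite /encloses in es *; cbn [arg pi_val ln_lo ln_up Li_up theta_up] in es |- *.
move=> En'; subst n'; case: es => n1 [hk [l0 [[hl hu] [hb ht]]]].
move=> h1 h2 h3 [_ [_ [l'0 [[hl' hu'] [hb' _]]]]].
have EN : IZR (Z.of_nat n) = INR n by rewrite INR_IZR_INZ.
have EK : IZR (Z.of_nat k) = INR k by rewrite INR_IZR_INZ.
have hn : 2 <= INR n by apply: (le_INR 2); lia.
move/IZR_le: h1; move/IZR_le: h2; move/IZR_le: h3.
rewrite !mult_IZR !minus_IZR !mult_IZR plus_IZR EN EK /scale => h3 h2 h1.
rewrite /scale in hl hu hb ht hl' hu' hb'.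
split; first by lra.
have L0 : 0 < ln (INR n) by apply: ln_gt0; lra.
have L1 : 0 < ln (INR n.+1) by apply: ln_gt0; rewrite S_INR; lra.
have k0 : 0 <= INR k by exact: pos_INR.
move=> x hx; rewrite /pi_Li_close (prime_piE hx) -hk.
rewrite S_INR in hx L1 hl' hu' hb'.
have Lpos y : INR n <= y -> 0.69 <= ln y.
  move=> hy; have [? _] := ln_2_3_bounds.
  by have : ln 2 <= ln y; [apply: ln_le; lra | lra].
have up : Li (INR n) + 0.4298 * (INR n / ln (INR n)) <= Li x + 0.4298 * (x / ln x).
  suff h y : INR n <= y <= x -> 0.4298 <= (0.4298 + 1) * ln y.
    by have := Li_comb_le (a := INR n) (b := x) ltac:(lra) ltac:(lra) h; lra.
  by move=> hy; have := Lpos y ltac:(lra); lra.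
have lo : Li x - 0.4298 * (x / ln x) <=
    Li (INR n + 1) - 0.4298 * ((INR n + 1) / ln (INR n + 1)).
  suff h y : x <= y <= INR n + 1 -> - 0.4298 <= (- 0.4298 + 1) * ln y.
    by have := Li_comb_le (a := x) (b := INR n + 1) ltac:(lra) ltac:(lra) h; lra.
  by move=> hy; have := Lpos y ltac:(lra); lra.
have hup : INR k <= Li (INR n) + 0.4298 * (INR n / ln (INR n)).
  have := @Li_diff_ge 2 (INR n) ltac:(lra) ltac:(lra); rewrite Li_2 => hLi.
  suff : INR k <= (1.4298 * INR n - 2) / ln (INR n) by rewrite /Rdiv in hLi *; lra.
  apply: (Rmult_le_reg_r (ln (INR n))) => //.
  have -> : (1.4298 * INR n - 2) / ln (INR n) * ln (INR n) = 1.4298 * INR n - 2.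
    by rewrite /Rdiv Rmult_assoc Rinv_l; lra.
  by have := Rmult_le_compat_l _ _ _ k0 hu; lra.
have hlo : Li (INR n + 1) - 0.4298 * ((INR n + 1) / ln (INR n + 1)) <= INR k.
  set L := ln (INR n + 1) in L1 hl' hu' *; set M := Li (INR n + 1) in hb' *.
  (* The product of enclosures below needs a nonnegative first factor. *)
  have [hMk|hMk] := Rle_lt_dec M (INR k).
    have : 0 <= (INR n + 1) / L by apply: Rdiv_le_0_compat; lra.
    by lra.
  suff : M - INR k <= 0.4298 * (INR n + 1) / L by rewrite /Rdiv; lra.
  apply: (Rmult_le_reg_r L) => //.
  have -> : 0.4298 * (INR n + 1) / L * L = 0.4298 * (INR n + 1).
    by rewrite /Rdiv Rmult_assoc Rinv_l; lra.
  have := Rmult_le_compat (1000000 * (M - INR k)) (IZR b' - INR k * 1000000)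
    (1000000 * L) (IZR u').
  by move=> /(_ ltac:(lra) ltac:(lra) ltac:(lra) ltac:(lra)); lra.
by apply: Rabs_le; lra.
Qed.

Lemma sweep_correct fuel s s' : encloses s -> sweep fuel s = Some s' ->
  encloses s' /\
  forall m, (arg s <= m < arg s')%N ->
    theta m <= 1.25 * INR m /\
    forall x, INR m <= x < INR m.+1 -> pi_Li_close x.
Proof.
elim: fuel s => [|fuel IH] s es /=.
  by case=> <-; split=> // m; lia.
case: ifP => // cs /(IH _ (next_encloses es)) [es' hm]; split=> // m hs.
have [->|ne] := eqVneq m (arg s); first exact: check_correct.
by apply: hm; rewrite /=; lia.
Qed.

Lemma sweep_start :
  sweep 1998 start = Some (Enclosure 2000 303 7589669 7622726 314399718 1946249694).
Proof. by vm_compute. Qed.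

Lemma below_2000 m : (1 < m < 2000)%N ->
  theta m <= 1.25 * INR m /\
  forall x, INR m <= x < INR m.+1 -> pi_Li_close x.
Proof.
by move=> hm; have [_] := sweep_correct start_encloses sweep_start; apply.
Qed.

Lemma at_2000 : 7.589 <= ln 2000 <= 7.623 /\ Li 2000 <= 314.4.
Proof.
have [[_ [_ [_ [hln [hLi _]]]]] _] := sweep_correct start_encloses sweep_start.
move: hln hLi; cbn [arg ln_lo ln_up Li_up theta_up]; rewrite /scale (_ : INR 2000 = 2000).
  by lra.
by rewrite INR_IZR_INZ; congr IZR; lia.
Qed.

(** * The range beyond 2000 *)

Lemma theta_bound m : theta m <= 1.25 * INR m.
Proof.
apply: theta_upper => {}m hm.
case: m hm => [|[|m]] hm; last by have [] := @below_2000 m.+2 hm.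
all: by rewrite /theta /primorial unlock /= ln_1; lra.
Qed.

(** Write y = x/log x.  From below, pi(x) >= 0.7799 y - 1.62, and
    1.209 y - Li(x) is increasing with value more than 2.7 at 2000, while
    1.209 < 0.7799 + 0.4298.  From above, pi(x) - Li(x) <= 0.25 Li(x) + 3.61,
    and 0.4298 y - 0.25 Li(x) is increasing with value more than 34 at 2000. *)
Lemma above_2000 x : 2000 <= x -> pi_Li_close x.
Proof.
move=> hx; have [[la ua] LiB] := at_2000.
have lnx y : 2000 <= y -> 7.589 <= ln y.
  by move=> hy; have : ln 2000 <= ln y; [apply: ln_le; lra | lra].
have L0 := lnx x hx.
have hq : 262.3 <= 2000 / ln 2000.
  by apply: (Rmult_le_reg_r (ln 2000)); first lra;
     rewrite /Rdiv Rmult_assoc Rinv_l; lra.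
apply: Rabs_le; split.
  have := prime_pi_lower (x := x) ltac:(lra).
  have : 4.6798 <= ln 108 <= 4.6848 by rewrite ln_108; have := ln_2_3_bounds; lra.
  move=> h108 hpi.
  have hrs y : 2000 <= y <= x -> 1.209 <= (1.209 + (-1)) * ln y.
    by move=> hy; have := lnx y ltac:(lra); lra.
  have hLi := Li_comb_le (a := 2000) ltac:(lra) hx hrs.
  have hi : / ln x <= 0.1318.
    by apply: (Rmult_le_reg_r (ln x)); first lra; rewrite Rinv_l; lra.
  have h : (x / 6 - 1) * 4.6798 / ln x <= 1 + INR (prime_pi x).
    apply: (Rmult_le_reg_r (ln x)); first lra.
    have := Rmult_le_compat_l (x / 6 - 1) _ _ ltac:(lra) h108.1.
    by rewrite /Rdiv Rmult_assoc Rinv_l; lra.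
  have hpos : 0 <= x / ln x by apply: Rdiv_le_0_compat; lra.
  by rewrite /Rdiv in h hLi hq hpos *; lra.
have [n hn] := nat_floor (x := x) ltac:(lra).
have := hn; rewrite S_INR => hn'.
have n1 : (1 < n)%N by apply/ltP/INR_lt; rewrite /=; lra.
have := primepi_upper n1 theta_bound; rewrite -(prime_piE hn).
have := @Li_le (INR n) x ltac:(lra) ltac:(lra).
have hrs y : 2000 <= y <= x -> 0.4298 <= (0.4298 + (-0.25)) * ln y.
  by move=> hy; have := lnx y ltac:(lra); lra.
have hLi := Li_comb_le (a := 2000) ltac:(lra) hx hrs.
have [h2 _] := ln_2_3_bounds.
have : 2.5 / ln 2 <= 3.61.
  by apply: (Rmult_le_reg_r (ln 2)); first lra; rewrite /Rdiv Rmult_assoc Rinv_l; lra.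
by lra.
Qed.

(** * Conclusion *)

Theorem corollary26 (x : R) (hx : 2 <= x) :
  Rabs (INR (prime_pi x) - Li x) <= 0.4298 * (x / ln x).
Proof.
have [/above_2000 //|x2000] := Rle_lt_dec 2000 x.
have [n hn] := nat_floor (x := x) ltac:(lra).
have := hn; rewrite S_INR => hn'.
suff /below_2000[_ /(_ x hn)] : (1 < n < 2000)%N by [].
apply/andP; split; apply/ltP/INR_lt; first by rewrite /=; lra.
rewrite (_ : INR 2000 = 2000); first lra.
by rewrite INR_IZR_INZ; congr IZR; lia.
Qed.
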